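(* Let $n,p\in\mathbb{N}$ and let $m$ be an even positive integer. Let $f_l$, $l=0,1,\ldots,p$, be real polynomials on $\mathbb{R}^n$ with essentially nonpositive coefficients and degree $m$, and consider the problem $$(P)\qquad \min_{x\in\mathbb{R}^n}\{f_0(x): f_l(x)\le 0,\ l=1,\ldots,p\},$$ whose feasible set is assumed nonempty. For $l=0,1,\ldots,p$, let $\tilde{\mathcal{F}}_l$ be the $m$th-order $(n+1)$-dimensional symmetric tensor associated with the canonical homogenization $\tilde f_l$ of $f_l$, that is, $\tilde f_l(\tilde x)=\langle\tilde{\mathcal{F}}_l,\tilde x^{\otimes m}\rangle$ for all $\tilde x=(x^T,t)^T\in\mathbb{R}^{n+1}$. Consider the conic program $$(CP)\qquad \min\{\langle\tilde{\mathcal{F}}_0,\mathcal{X}\rangle:\ \langle\tilde{\mathcal{F}}_l,\mathcal{X}\rangle\le 0,\ l=1,\ldots,p,\ \mathcal{X}_{n+1\cdots n+1}=1,\ \mathcal{X}\in U_{m,n+1}\}.$$ Then $\min(P)=\min(CP)$. Moreover, for any (optimal) solution $\bar{\mathcal{X}}$ of $(CP)$, the vector $$\bar x:=\left(\sqrt[m]{\bar{\mathcal{X}}_{1\cdots 1}},\ldots,\sqrt[m]{\bar{\mathcal{X}}_{n\cdots n}}\right)\in\mathbb{R}^n$$ is an (optimal) solution of $(P)$.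
   Context: $\mathbb{N}=\{1,2,\ldots\}$. $\min(P)$ and $\min(CP)$ denote the optimal values (infima in $[-\infty,+\infty]$) of the problems. Polynomials with essentially nonpositive coefficients: let $f=\sum_{\alpha}f_\alpha x^\alpha$ be a real polynomial on $\mathbb{R}^n$ of degree $m$, where $x^\alpha=x_1^{\alpha_1}\cdots x_n^{\alpha_n}$ and $|\alpha|=\sum_i\alpha_i$. Put $\Omega_f=\{\alpha\in(\mathbb{N}\cup\{0\})^n: f_\alpha\ne 0,\ \alpha\ne m e_i,\ i=1,\ldots,n\}$, where $e_i$ is the $i$th standard unit vector. $f$ has essentially nonpositive coefficients if $f_\alpha\le 0$ for all $\alpha\in\Omega_f\setminus\{0\}$ (so the coefficients of $x_1^m,\ldots,x_n^m$ and the constant term are arbitrary). The canonical homogenization of $f=\sum_{0\le|\alpha|\le m}f_\alpha x^\alpha$ of degree $m$ is $\tilde f(x,t)=\sum_{0\le|\alpha|\le m}f_\alpha x^\alpha t^{m-|\alpha|}$, a homogeneous polynomial of degree $m$ on $\mathbb{R}^{n+1}$. An $m$th-order $N$-dimensional tensor is a real array $\mathcal{A}=(\mathcal{A}_{i_1\cdots i_m})_{1\le i_1,\ldots,i_m\le N}$; it is symmetric if its entries are invariant under permutations of the indices. $\langle\mathcal{A},\mathcal{B}\rangle=\sum_{i_1,\ldots,i_m=1}^{N}\mathcal{A}_{i_1\cdots i_m}\mathcal{B}_{i_1\cdots i_m}$, and $y^{\otimes m}$ has entries $y_{i_1}\cdots y_{i_m}$ for $y\in\mathbb{R}^N$. Each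 homogeneous polynomial of degree $m$ on $\mathbb{R}^N$ equals $y\mapsto\langle\mathcal{A},y^{\otimes m}\rangle$ for a unique symmetric tensor $\mathcal{A}$. $U_{m,N}:=\mathrm{conv}\{y^{\otimes m}:y\in\mathbb{R}^N\}$ (convex hull in the space of symmetric tensors). Diagonal entries of elements of $U_{m,N}$ are nonnegative since $m$ is even; $\sqrt[m]{\cdot}$ denotes the nonnegative $m$th root. *)

(* Defs.v *)
From HB Require Import structures.
From mathcomp Require Import all_boot all_order all_algebra perm.
From mathcomp Require Import boolp classical_sets reals constructive_ereal ereal.
From mathcomp Require Import exp convex.
(* The notations of mpoly clash with those of MathComp-Analysis:
   [mpoly n R] is {mpoly R[n]}, [mcoeff a f] is f@_a, [meval v f] is f.@[v],
   and [mnm_muln (mnm1 i) m] is the monomial U_(i) *+ m. *)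
From mathcomp Require Import -(notations) mpoly.

Set Implicit Arguments.
Unset Strict Implicit.
Unset Printing Implicit Defensive.

Import Order.TTheory GRing.Theory Num.Theory.
Local Open Scope classical_set_scope.
Local Open Scope ring_scope.

Section Optimization.
Context {R : realType} {T : Type}.
Implicit Types (D : set T) (obj : T -> R).

Definition optimal_value D obj : \bar R := ereal_inf [set (obj x)%:E | x in D].

Definition optimal_solution D obj (x : T) : Prop :=
  D x /\ forall y, D y -> obj x <= obj y.

End Optimization.

Definition convex_hull {R : realType} {E : lmodType R} (S : set E) : set E :=
  smallest (@convex_set R E) S.

Section EssentiallyNonpositive.
Context {R : realType} {n : nat}.
Implicit Type f : mpoly n R.

(* msize is one more than the total degree, and is 0 for the zero polynomial *)
Definition has_degree (m : nat) f : Prop := @mmeasure n R mdeg f = m.+1.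

(* Used only when f has degree m *)
Definition Omega (m : nat) f : set (multinom n) :=
  [set a | mcoeff a f != 0 /\ forall i : 'I_n, a <> mnm_muln (mnm1 i) m].

Definition essentially_nonpositive (m : nat) f : Prop :=
  forall a, (Omega m f `\ @mnm0 n) a -> mcoeff a f <= 0.

(* The homogenizing variable t is the last of the n + 1 variables. *)
Definition homogenization (m : nat) f : mpoly (n + 1) R :=
  \sum_(a : bmultinom n m.+1)
    mcoeff a f *: mpolyX R (Multinom [tuple of a ++ [tuple (m - mdeg a)%N]]).

End EssentiallyNonpositive.

(* m-th order N-dimensional tensors; R^o provides the vector space structure *)
Definition tensor (R : realType) (m N : nat) := {ffun m.-tuple 'I_N -> R^o}.

Section Tensors.
Context {R : realType} {m N : nat}.
Implicit Types (A B : tensor R m N) (y : 'rV[R]_N).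

Definition symmetric_tensor A : Prop :=
  forall (s : 'S_m) (i : m.-tuple 'I_N), A [tuple tnth i (s k) | k < m] = A i.

Definition tdot A B : R := \sum_(i : m.-tuple 'I_N) A i * B i.

Definition tpow y : tensor R m N :=
  [ffun i : m.-tuple 'I_N => \prod_(k < m) y ord0 (tnth i k)].

Definition tdiag A (j : 'I_N) : R := A [tuple of nseq m j].

Definition represents A (g : mpoly N R) : Prop :=
  forall y, meval (y ord0) g = tdot A (tpow y).

End Tensors.

Definition Ucone {R : realType} {m N : nat} : set (tensor R m N) :=
  convex_hull (range (@tpow R m N)).

Definition feasible_P {R : realType} {n p : nat} (f : 'I_p.+1 -> mpoly n R) :
    set 'rV[R]_n :=
  [set x | forall l : 'I_p.+1, (0 < l)%N -> meval (x ord0) (f l) <= 0].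

Definition feasible_CP {R : realType} {n p m : nat}
    (F : 'I_p.+1 -> tensor R m (n + 1)) : set (tensor R m (n + 1)) :=
  [set X | [/\ forall l : 'I_p.+1, (0 < l)%N -> tdot (F l) X <= 0,
               tdiag X (rshift n ord0) = 1
             & Ucone X]].

(* Main.v *)
(* For X in U_{m,n+1}, Hoelder's inequality bounds every entry X_{i_1...i_m} by
   the product of the m-th roots of the diagonal entries at i_1, ..., i_m, with
   equality on the diagonal. The coefficients of f_l attached to off-diagonal
   entries are nonpositive, so if the last diagonal entry is 1, the vector of
   roots xbar satisfies f_l(xbar) <= <F_l, X>. Conversely the m-th tensor power
   X of (x, 1) satisfies <F_l, X> = f_l(x). *)
Require Import Defs.
From HB Require Import structures.
From mathcomp Require Import all_boot all_order all_algebra perm.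
From mathcomp Require Import boolp classical_sets reals constructive_ereal ereal.
From mathcomp Require Import exp convex.
From mathcomp Require Import -(notations) mpoly.

Set Implicit Arguments.
Unset Strict Implicit.
Unset Printing Implicit Defensive.

Import Order.TTheory GRing.Theory Num.Theory.
Local Open Scope classical_set_scope.
Local Open Scope ring_scope.

(** * Real m-th roots and a Hoelder-type inequality *)

Lemma powR_prod (R : realType) (I : finType) (u : I -> R) (r : R) :
  (forall k, 0 <= u k) -> powR (\prod_k u k) r = \prod_k powR (u k) r.
Proof.
move=> u_ge0.
(* Nonnegativity is carried through the induction because [powRM] needs both factors nonnegative. *)
suff [] : 0 <= \prod_k u k /\ powR (\prod_k u k) r = \prod_k powR (u k) r by [].
elim/big_rec2: _ => [|k x y _ [y_ge0 <-]]; first by rewrite powR1.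
by rewrite mulr_ge0 // powRM.
Qed.

Lemma powR_invnK (R : realType) (m : nat) (x : R) :
  (0 < m)%N -> 0 <= x -> powR x m%:R^-1 ^+ m = x.
Proof.
move=> m_gt0 x_ge0; rewrite -powR_mulrn ?powR_ge0 // -powRrM.
by rewrite mulVf ?powRr1 // pnatr_eq0 -lt0n.
Qed.

Lemma exprnK_powR (R : realType) (m : nat) (x : R) :
  (0 < m)%N -> 0 <= x -> powR (x ^+ m) m%:R^-1 = x.
Proof.
move=> m_gt0 x_ge0; rewrite -powR_mulrn // -powRrM.
by rewrite mulfV ?powRr1 // pnatr_eq0 -lt0n.
Qed.

Lemma prodr_const_ord (R : pzSemiRingType) (m : nat) (x : R) :
  \prod_(k < m) x = x ^+ m.
Proof. by rewrite prodr_const card_ord. Qed.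

(** AM-GM bounds the product by the m-th power of the mean; the m-th root is monotone and
    multiplicative. *)
Lemma prod_powR_invn_le_mean (R : realType) (m : nat) (u : 'I_m -> R) :
  (0 < m)%N -> (forall k, 0 <= u k) ->
  \prod_k powR (u k) m%:R^-1 <= (\sum_k u k) / m%:R.
Proof.
move=> m_gt0 u_ge0.
have mean_ge0 : 0 <= (\sum_k u k) / m%:R by rewrite divr_ge0 ?sumr_ge0.
have AGM : \prod_k u k <= ((\sum_k u k) / m%:R) ^+ m.
  by have [+ _] := @leif_AGM _ _ predT u (in1W u_ge0); rewrite card_ord.
rewrite -powR_prod // -[leRHS](exprnK_powR m_gt0) //.
by apply: ge0_ler_powR; rewrite ?nnegrE ?prodr_ge0 ?exprn_ge0 ?invr_ge0.
Qed.

(* Divide by the right-hand side and apply AM-GM to both ratios. *)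
Lemma prod_powR_invnD (R : realType) (m : nat) (a b : 'I_m -> R) :
  (0 < m)%N -> (forall k, 0 <= a k) -> (forall k, 0 <= b k) ->
  \prod_k powR (a k) m%:R^-1 + \prod_k powR (b k) m%:R^-1
    <= \prod_k powR (a k + b k) m%:R^-1.
Proof.
move=> m_gt0 a_ge0 b_ge0.
have m_neq0 : m%:R != 0 :> R by rewrite pnatr_eq0 -lt0n.
(* The ratios need nonzero sums. If [a k + b k] vanishes, so do [a k] and [b k], and all three
   products are 0. *)
have [/existsP[k]|/existsPn s_neq0] := boolP [exists k, a k + b k == 0].
  rewrite paddr_eq0 // => /andP[/eqP ak0 /eqP bk0].
  have prod0 (c : 'I_m -> R) : c k = 0 -> \prod_k powR (c k) m%:R^-1 = 0.
    by move=> ck0; rewrite (bigD1 k) //= ck0 powR0 ?invr_eq0 // mul0r.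
  by rewrite !prod0 ?ak0 ?bk0 ?addr0.
pose s k := a k + b k.
have s_gt0 k : 0 < s k by rewrite lt0r s_neq0 addr_ge0.
have splitE (c : 'I_m -> R) : (forall k, 0 <= c k) ->
    \prod_k powR (c k) m%:R^-1 =
    \prod_k powR (c k / s k) m%:R^-1 * \prod_k powR (s k) m%:R^-1.
  move=> c_ge0; rewrite -big_split; apply: eq_bigr => k _ /=.
  by rewrite -powRM ?divr_ge0 ?(ltW (s_gt0 k)) // divfK ?gt_eqF.
rewrite splitE // [X in _ + X]splitE // -mulrDl ler_piMl //.
  by apply: prodr_ge0 => k _; exact: powR_ge0.
have ratio_ge0 (c : 'I_m -> R) : (forall k, 0 <= c k) -> forall k, 0 <= c k / s k.
  by move=> c_ge0 k; rewrite divr_ge0 // ltW.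
(* The two means add up to 1, because the two ratios at each [k] do. *)
apply: le_trans (lerD (prod_powR_invn_le_mean m_gt0 (ratio_ge0 a a_ge0))
                      (prod_powR_invn_le_mean m_gt0 (ratio_ge0 b b_ge0))) _.
rewrite -mulrDl -big_split /=.
under eq_bigr => k _ do rewrite -mulrDl divff ?gt_eqF ?s_gt0 //.
by rewrite sumr_const card_ord divff.
Qed.

(** * Monomials as lists of indices *)

Lemma prod_m2s (R : comNzRingType) (N : nat) (b : multinom N) (g : 'I_N -> R) :
  \prod_(j <- m2s b) g j = \prod_j g j ^+ b j.
Proof.
rewrite /m2s big_flatten /= big_map big_enum /=; apply: eq_bigr => j _.
by rewrite big_nseq -[RHS]mulr1 -iter_mulr.
Qed.

Lemma m2s_nseq (N : nat) (b : multinom N) (j0 : 'I_N) :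
  (forall j, j != j0 -> b j = 0%N) -> m2s b = nseq (mdeg b) j0.
Proof.
move=> b0; rewrite -size_m2s; apply/all_pred1P/allP => j /flatten_mapP[i _].
rewrite mem_nseq => /andP[bi_gt0 /eqP ->] /=.
by case: (eqVneq i j0) bi_gt0 => // /b0 ->.
Qed.

(** * The convex hull of the tensor powers *)

Section UconeTheory.
Context {R : realType} {m N : nat}.
Implicit Types (A B X Y : tensor R m N) (y : 'rV[R]_N).

(** A set closed under nonnegative combinations is convex, so it contains the hull once it contains
    the generators. The weights need not sum to 1. *)
Lemma Ucone_ind (S : set (tensor R m N)) :
  (forall y, S (tpow y)) ->
  (forall (c d : R) X Y, 0 <= c -> 0 <= d -> S X -> S Y ->
     S (c *: X + d *: Y)) ->
  forall X, Ucone X -> S X.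
Proof.
move=> S_tpow S_comb; apply: smallest_sub => [X Y l|_ [y _ <-]//].
by rewrite !inE => SX SY; apply: S_comb; rewrite ?subr_ge0 ?le1 ?ge0.
Qed.

Lemma tpow_Ucone y : Ucone (tpow y : tensor R m N).
Proof. by apply: sub_gen_smallest; exists y. Qed.

Lemma tdotDZr A X Y (c d : R) :
  tdot A (c *: X + d *: Y) = c * tdot A X + d * tdot A Y.
Proof.
rewrite /tdot !mulr_sumr -big_split; apply: eq_bigr => i _ /=.
by rewrite !ffunE /= mulrDr !(mulrCA (A i)).
Qed.

(** Pairing is linear, so agreement on the generators spreads to the hull, even if [A] and [B]
    differ entrywise. *)
Lemma Ucone_tdot_eq A B :
  (forall y, tdot A (tpow y) = tdot B (tpow y)) ->
  forall X, Ucone X -> tdot A X = tdot B X.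
Proof.
move=> eqAB; apply: Ucone_ind => // c d X Y _ _ eqX eqY.
by rewrite !tdotDZr eqX eqY.
Qed.

Lemma tdiag_tpow y j : tdiag (tpow y : tensor R m N) j = y ord0 j ^+ m.
Proof.
rewrite /tdiag ffunE -[RHS]prodr_const_ord.
by apply: eq_bigr => k _; rewrite tnth_nseq.
Qed.

Hypotheses (m_gt0 : (0 < m)%N) (m_even : ~~ odd m).

(* Hoelder's inequality, in the form that survives convex combinations. *)
Lemma Ucone_le_diag X : Ucone X ->
  (forall j, 0 <= tdiag X j) /\
  (forall i, X i <= \prod_k powR (tdiag X (tnth i k)) m%:R^-1).
Proof.
move: X; apply: Ucone_ind => [y|c d X Y c_ge0 d_ge0 [X0 leX] [Y0 leY]].
  split=> [j|i]; first by rewrite tdiag_tpow exprn_even_ge0.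
  (* On a tensor power the bound is the absolute value of the entry: as [m] is even, the m-th root
     of y_j^m is |y_j|. *)
  rewrite ffunE (le_trans (ler_norm _)) // normr_prod.
  rewrite le_eqVlt; apply/orP; left; apply/eqP; apply: eq_bigr => k _.
  rewrite tdiag_tpow -[X in powR X _]ger0_norm ?exprn_even_ge0 // normrX.
  by rewrite exprnK_powR.
have diagE j : tdiag (c *: X + d *: Y) j = c * tdiag X j + d * tdiag Y j.
  by rewrite /tdiag !ffunE.
split=> [j|i]; first by rewrite diagE addr_ge0 ?mulr_ge0.
(* The bound is homogeneous of degree 1: each of the [m] factors contributes an m-th root of [e]. *)
have scal (e : R) (Z : tensor R m N) : 0 <= e -> (forall j, 0 <= tdiag Z j) ->
    \prod_k powR (e * tdiag Z (tnth i k)) m%:R^-1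
    = e * \prod_k powR (tdiag Z (tnth i k)) m%:R^-1.
  move=> e_ge0 Z0; under eq_bigr do rewrite powRM //.
  by rewrite big_split /= prodr_const_ord powR_invnK.
under eq_bigr do rewrite diagE.
apply: le_trans (prod_powR_invnD m_gt0 _ _) => [|k|k]; rewrite ?mulr_ge0 //.
by rewrite !scal // !ffunE lerD // ler_wpM2l.
Qed.

End UconeTheory.

(** * Homogenization and its coefficient tensor *)

Section Homogenization.
Context {R : realType} {n : nat} (m : nat).
Implicit Types (a : bmultinom n m.+1) (f : mpoly n R).

Definition hom_mnm (a : multinom n) : multinom (n + 1) :=
  Multinom [tuple of a ++ [tuple (m - mdeg a)%N]].

Lemma hom_mnm_lshift (a : multinom n) i : hom_mnm a (lshift 1 i) = a i.
Proof. by rewrite /fun_of_multinom /= tnth_lshift. Qed.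

Lemma hom_mnm_rshift (a : multinom n) i :
  hom_mnm a (rshift n i) = (m - mdeg a)%N.
Proof. by rewrite /fun_of_multinom /= tnth_rshift ord1. Qed.

Lemma mdeg_hom_mnm a : mdeg (hom_mnm a) = m.
Proof.
rewrite mdegE big_split_ord /= big_ord1 hom_mnm_rshift.
under eq_bigr do rewrite hom_mnm_lshift.
by rewrite -mdegE subnKC // -ltnS bmdeg.
Qed.

Lemma size_m2s_hom a : size (m2s (hom_mnm a)) == m.
Proof. by rewrite size_m2s mdeg_hom_mnm. Qed.

(** One representative, in increasing order, of the index tuples whose entry multiplies the
    coefficient of [a]. *)
Definition hom_tuple a : m.-tuple 'I_(n + 1) := Tuple (size_m2s_hom a).

Lemma prod_hom_tuple (g : 'I_(n + 1) -> R) a :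
  \prod_k g (tnth (hom_tuple a) k) =
  (\prod_(i < n) g (lshift 1 i) ^+ a i) * g (rshift n ord0) ^+ (m - mdeg a).
Proof.
rewrite -(big_tuple _ _ (hom_tuple a) xpredT g) prod_m2s big_split_ord /=.
rewrite big_ord1 hom_mnm_rshift; congr (_ * _).
by apply: eq_bigr => i _; rewrite hom_mnm_lshift.
Qed.

(** The constant term and, by the next lemma, the pure powers x_i^m sit on the diagonal; these are
    the coefficients of arbitrary sign. *)
Lemma hom_tuple0 a : a = @mnm0 n :> multinom n ->
  hom_tuple a = [tuple of nseq m (rshift n ord0)].
Proof.
move=> a0; apply: val_inj; rewrite /= -{2}(mdeg_hom_mnm a); apply: m2s_nseq.
move=> j; case: (split_ordP j) => i ->; last by rewrite ord1 eqxx.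
by rewrite hom_mnm_lshift a0 mnm0E.
Qed.

Lemma hom_tuple_muln a i : a = mnm_muln (mnm1 i) m :> multinom n ->
  hom_tuple a = [tuple of nseq m (lshift 1 i)].
Proof.
move=> a0; apply: val_inj; rewrite /= -{2}(mdeg_hom_mnm a); apply: m2s_nseq.
move=> j; case: (split_ordP j) => k ->.
  rewrite (inj_eq (@lshift_inj _ _)) hom_mnm_lshift a0 mulmnE mnm1E eq_sym.
  by move/negbTE ->.
by rewrite hom_mnm_rshift a0 mdegMn mdeg1 mul1n subnn.
Qed.

(* Each coefficient sits at a single index: this tensor is not symmetric, but on
   U_{m,n+1} it pairs like the symmetric one. *)
Definition coef_tensor f : tensor R m (n + 1) :=
  [ffun i => \sum_(a : bmultinom n m.+1 | hom_tuple a == i) mcoeff a f].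

Lemma tdot_coef_tensor f (X : tensor R m (n + 1)) :
  tdot (coef_tensor f) X =
  \sum_(a : bmultinom n m.+1) mcoeff a f * X (hom_tuple a).
Proof.
rewrite [RHS](partition_big hom_tuple xpredT) //=; apply: eq_bigr => i _.
by rewrite ffunE mulr_suml; apply: eq_bigr => a /eqP <-.
Qed.

Lemma meval_homogenization f (y : 'rV[R]_(n + 1)) :
  meval (y ord0) (homogenization m f) = tdot (coef_tensor f) (tpow y).
Proof.
rewrite tdot_coef_tensor raddf_sum /=; apply: eq_bigr => a _.
rewrite mevalZ mevalX ffunE; congr (_ * _).
by rewrite -(big_tuple _ _ (hom_tuple a) xpredT (y ord0)) prod_m2s.
Qed.

Lemma meval_bmultinom f (x : 'I_n -> R) : has_degree m f ->
  meval x f =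
  \sum_(a : bmultinom n m.+1) mcoeff a f * \prod_(i < n) x i ^+ a i.
Proof.
move=> f_deg; rewrite [in LHS](@mpolywE _ _ m.+1 f) ?f_deg //.
by rewrite raddf_sum /=; apply: eq_bigr => a _; rewrite mevalZ mevalX.
Qed.

Lemma meval_homogenization1 f (x : 'rV[R]_n) : has_degree m f ->
  meval (row_mx x (1 : 'rV_1) ord0) (homogenization m f) = meval (x ord0) f.
Proof.
move=> f_deg; rewrite meval_homogenization tdot_coef_tensor meval_bmultinom //.
apply: eq_bigr => a _; rewrite ffunE prod_hom_tuple; congr (_ * _).
rewrite row_mxEr mxE expr1n mulr1.
by apply: eq_bigr => i _; rewrite row_mxEl.
Qed.

Lemma meval_root_diag_le f (X : tensor R m (n + 1)) :
  (0 < m)%N -> ~~ odd m -> has_degree m f -> essentially_nonpositive m f ->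
  Ucone X -> tdiag X (rshift n ord0) = 1 ->
  meval ((\row_(i < n) powR (tdiag X (lshift 1 i)) m%:R^-1) ord0) f
    <= tdot (coef_tensor f) X.
Proof.
move=> m_gt0 m_even f_deg f_npos UX X1.
have [X_ge0 X_le] := Ucone_le_diag m_gt0 m_even UX.
rewrite meval_bmultinom // tdot_coef_tensor; apply: ler_sum => a _.
(* Since the last diagonal entry is 1, powers of the homogenizing variable contribute 1, and the
   monomial becomes the Hoelder bound at [hom_tuple a]. *)
have -> : \prod_(i < n) (\row_(i < n) powR (tdiag X (lshift 1 i)) m%:R^-1)
    ord0 i ^+ a i = \prod_k powR (tdiag X (tnth (hom_tuple a) k)) m%:R^-1.
  rewrite (prod_hom_tuple (fun j => powR (tdiag X j) m%:R^-1)) X1 powR1.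
  by rewrite expr1n mulr1; apply: eq_bigr => i _; rewrite mxE.
have const j : hom_tuple a = [tuple of nseq m j] ->
    \prod_k powR (tdiag X (tnth (hom_tuple a) k)) m%:R^-1 = X (hom_tuple a).
  move=> ->; under eq_bigr do rewrite tnth_nseq.
  by rewrite prodr_const_ord powR_invnK.
have [->|fa0] := eqVneq (mcoeff a f) 0; first by rewrite !mul0r.
have [a0|a_neq0] := pselect (a = @mnm0 n :> multinom n).
  by rewrite (const _ (hom_tuple0 a0)).
have [[i ai]|a_neqU] := pselect (exists i, a = mnm_muln (mnm1 i) m :> multinom n).
  by rewrite (const _ (hom_tuple_muln ai)).
(* Here [a] lies in [Omega] and is nonzero, so its coefficient is nonpositive and reverses
   [X_le]. *)
rewrite ler_wnM2l //; apply: f_npos; split => //; split => // i ai.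
by apply: a_neqU; exists i.
Qed.

End Homogenization.

(** * Comparison of the two programs *)

Theorem theorem4p1 (R : realType) (n p m : nat)
    (n_gt0 : (0 < n)%N) (p_gt0 : (0 < p)%N) (m_gt0 : (0 < m)%N)
    (m_even : ~~ odd m)
    (f : 'I_p.+1 -> mpoly n R)
    (f_deg : forall l, has_degree m (f l))
    (f_npos : forall l, essentially_nonpositive m (f l))
    (P_feasible : feasible_P f !=set0)
    (F : 'I_p.+1 -> tensor R m (n + 1))
    (F_sym : forall l, symmetric_tensor (F l))
    (F_repr : forall l, represents (F l) (homogenization m (f l))) :
  let objP (x : 'rV[R]_n) := meval (x ord0) (f ord0) in
  let objCP (X : tensor R m (n + 1)) := tdot (F ord0) X in
  optimal_value (feasible_P f) objP = optimal_value (feasible_CP F) objCP /\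
  forall X : tensor R m (n + 1),
    optimal_solution (feasible_CP F) objCP X ->
    optimal_solution (feasible_P f) objP
      (\row_(i < n) powR (tdiag X (lshift 1 i)) m%:R^-1).
Proof.
move=> objP objCP.
(* [F_repr] speaks only of tensor powers; linearity extends it to the hull. *)
have tdotE l X : Ucone X -> tdot (F l) X = tdot (coef_tensor m (f l)) X.
  apply: Ucone_tdot_eq => y.
  by rewrite -F_repr meval_homogenization.
pose lift (x : 'rV[R]_n) : tensor R m (n + 1) := tpow (row_mx x (1 : 'rV_1)).
pose root (X : tensor R m (n + 1)) : 'rV[R]_n :=
  \row_(i < n) powR (tdiag X (lshift 1 i)) m%:R^-1.
have liftE l x : tdot (F l) (lift x) = meval (x ord0) (f l).
  by rewrite -F_repr meval_homogenization1.
have lift_feasible x : feasible_P f x -> feasible_CP F (lift x).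
  move=> Px; split=> [l l_gt0||]; last exact: tpow_Ucone.
    by rewrite liftE; exact: Px.
  by rewrite tdiag_tpow row_mxEr mxE expr1n.
have root_le l X : feasible_CP F X ->
    meval (root X ord0) (f l) <= tdot (F l) X.
  by case=> _ X1 UX; rewrite tdotE // meval_root_diag_le.
have root_feasible X : feasible_CP F X -> feasible_P f (root X).
  move=> CX l l_gt0; apply: le_trans (root_le l X CX) _.
  by case: CX => + _ _; exact.
split; last first.
  move=> X [CX Xmin]; split; first exact: root_feasible.
  move=> y Py; apply: le_trans (root_le ord0 X CX) _.
  by rewrite /objP -liftE; apply: Xmin; exact: lift_feasible.
(* For each inequality, every feasible point of one program yields one of the other with no larger
   objective: [root] for the first, [lift] for the second. *)
apply/eqP; rewrite eq_le; apply/andP; split;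
  apply: le_ereal_inf_tmp => _ [z Dz <-]; apply: ge_ereal_inf.
  exists (objP (root z))%:E; last by rewrite lee_fin; exact: root_le.
  by exists (root z) => //; exact: root_feasible.
exists (objCP (lift z))%:E; last by rewrite /objCP liftE.
by exists (lift z) => //; exact: lift_feasible.
Qed.
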